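(* Let $\mathcal{K}\subset\mathbb{R}^n$ be a compact basic semialgebraic set with nonempty interior, let $\mathcal{B}=\mathcal{B}_1\times\cdots\times\mathcal{B}_n\supseteq\mathcal{K}$ be a compact semialgebraic set that is a cartesian product of $n$ one-dimensional sets, let $d>0$ be an integer, and let $p_d^*$ be an optimal solution of the problem $$w_d^*:=\min_{p\in\mathcal{P}_d}\int_{\mathcal{B}}p(x)\,dx\quad\text{s.t.}\quad p\ge 1\text{ on }\mathcal{K},\quad p\ge 0\text{ on }\mathcal{B},$$ so that $w_d^*=\int_{\mathcal{B}}p_d^*(x)\,dx$. Then the sampling algorithm described in the context (Algorithm 1), run with $p_d^*$, returns a sample uniformly distributed in $\mathcal{K}$, i.e. with density $\mathbb{I}_{\mathcal{K}}(x)/\mathrm{vol}(\mathcal{K})$. Moreover, the acceptance rate of the algorithm is $$\gamma_d=\frac{\mathrm{vol}(\mathcal{K})}{w_d^*}.$$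
   Context: $\mathcal{K}=\{x\in\mathbb{R}^n : g_i(x)\ge 0,\ i=1,\dots,m\}$ with given real multivariate polynomials $g_1,\dots,g_m$. $\mathcal{P}_d$ is the vector space of real polynomials in $n$ variables of degree at most $d$. $\mathrm{vol}$ denotes Lebesgue measure on $\mathbb{R}^n$, and $\mathbb{I}_{\mathcal{K}}$ is the indicator function of $\mathcal{K}$ (equal to $1$ on $\mathcal{K}$ and $0$ elsewhere). Algorithm 1: 1. For the given integer $d>0$, compute an optimal solution $p_d^*$ of the problem of minimizing $\int_{\mathcal{B}}p(x)\,dx$ over $p\in\mathcal{P}_d$ subject to $p\ge 1$ on $\mathcal{K}$ and $p\ge 0$ on $\mathcal{B}$. 2. Generate a random sample $\xi$ with density proportional to $p_d^*$ over $\mathcal{B}$. 3. If $\xi\notin\mathcal{K}$, restart with a new sample (go to step 2). 4. Generate a sample $u$ uniform on $[0,1]$. 5. If $u\,p_d^*(\xi)\le 1$, return $x=\xi$; otherwise restart with a new sample (go to step 2). All random draws (the successive samples $\xi$ and $u$) are mutually independent. The acceptance rate of the algorithm is defined as one over the expected number of samples that have to be drawn from the density proportional to $p_d^*$ (step 2) in order to obtain one accepted (returned) sample. *)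

(* Defs.v *)
Set Warnings "-notation-overridden,-notation-incompatible-prefix,-ambiguous-paths".
Set Warnings "-redundant-canonical-projection".
From HB Require Import structures.
From mathcomp Require Import all_boot all_order all_algebra finmap.
From mathcomp Require Import all_classical all_reals all_analysis.
From mathcomp Require mpoly.

Set Implicit Arguments.
Unset Strict Implicit.
Unset Printing Implicit Defensive.

Import Order.TTheory GRing.Theory Num.Theory.
Import numFieldNormedType.Exports.

Local Open Scope classical_set_scope.
Local Open Scope ring_scope.

(* R^n is 'rV[R]_n with its library topology, and with the product (= Borel)
   sigma-algebra, i.e. the one generated by the coordinates. *)
Definition measure_rV_display : measure_display -> measure_display.
Proof. exact. Qed.

Section measurable_rV.
Context {d} {T : sigmaRingType d}.
Variable n : nat.

Let coord (i : 'I_n) (x : 'rV[T]_n) : T := x ord0 i.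

Let rV_set0 : g_sigma_preimage coord set0.
Proof. exact: sigma_algebra0. Qed.

Let rV_setC A : g_sigma_preimage coord A -> g_sigma_preimage coord (~` A).
Proof. exact: sigma_algebraC. Qed.

Let rV_bigcup (F : (set 'rV[T]_n)^nat) :
  (forall i, g_sigma_preimage coord (F i)) ->
  g_sigma_preimage coord (\bigcup_i (F i)).
Proof. exact: sigma_algebra_bigcup. Qed.

HB.instance Definition _ := @isMeasurable.Build (measure_rV_display d)
  'rV[T]_n (g_sigma_preimage coord) rV_set0 rV_setC rV_bigcup.

End measurable_rV.

Lemma measurable_coord d (T : measurableType d) n (i : 'I_n) :
  measurable_fun setT (fun x : 'rV[T]_n => x ord0 i).
Proof.
move=> _ Y mY; rewrite setTI; apply: sub_sigma_algebra.
rewrite -bigcup_seq/=; exists i => /=; first by rewrite mem_index_enum.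
by exists Y => //; rewrite setTI.
Qed.

Lemma measurable_fun_rV d d' (S : measurableType d') (T : measurableType d) n
    (f : S -> 'rV[T]_n) :
  (forall i, measurable_fun setT (fun s => f s ord0 i)) ->
  measurable_fun setT f.
Proof.
move=> mf _ A mA; rewrite setTI.
pose coord (i : 'I_n) (x : 'rV[T]_n) := x ord0 i.
have : preimage_set_system setT f (g_sigma_preimage coord) (f @^-1` A).
  by exists A; rewrite ?setTI.
rewrite -g_sigma_preimage_comp; apply: smallest_sub.
  exact: sigma_algebra_measurable.
rewrite -bigcup_seq => _ [i _ [B mB <-]].
exact: mf.
Qed.

Section lebesgue_rV_succ.
Context {R : realType} (n : nat).

Definition cons_rV (p : measurableTypeR R * 'rV[R]_n) : 'rV[R]_n.+1 :=
  \row_i (if unlift ord0 i is Some j then p.2 ord0 j else p.1).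

Lemma measurable_cons_rV : measurable_fun setT cons_rV.
Proof.
apply: measurable_fun_rV => i; under eq_fun do rewrite mxE.
case: unlift => [j|]; last exact: measurable_fst.
exact: measurableT_comp (@measurable_coord _ _ _ j) measurable_snd.
Qed.

Variable mu : {sigma_finite_measure set 'rV[R]_n -> \bar R}.

Definition lebesgue_rV_succ : set 'rV[R]_n.+1 -> \bar R :=
  pushforward (lebesgue_measure \x mu)%E cons_rV.

Let lebesgue_rV_succ0 : lebesgue_rV_succ set0 = 0%E.
Proof. by rewrite /lebesgue_rV_succ /pushforward preimage_set0 measure0. Qed.

Let lebesgue_rV_succ_ge0 A : (0 <= lebesgue_rV_succ A)%E.
Proof. by rewrite /lebesgue_rV_succ /pushforward; exact: measure_ge0. Qed.

Let lebesgue_rV_succ_sigma_additive : semi_sigma_additive lebesgue_rV_succ.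
Proof.
have mcons (A : set 'rV[R]_n.+1) : measurable A -> measurable (cons_rV @^-1` A).
  by move=> mA; rewrite -[X in measurable X]setTI; exact: measurable_cons_rV.
move=> F mF tF mUF; rewrite /lebesgue_rV_succ /pushforward preimage_bigcup.
apply: measure_semi_sigma_additive => [k||].
- exact: mcons.
- apply/trivIsetP => i j _ _ ij; rewrite -preimage_setI.
  by move/trivIsetP : tF => ->//; rewrite preimage_set0.
- by rewrite -preimage_bigcup; exact: mcons.
Qed.

HB.instance Definition _ := isMeasure.Build _ _ _ lebesgue_rV_succ
  lebesgue_rV_succ0 lebesgue_rV_succ_ge0 lebesgue_rV_succ_sigma_additive.

Lemma lebesgue_rV_succ_sigma_finite : sigma_finite setT lebesgue_rV_succ.
Proof.
(* The library's sigma-finiteness instance on [\x] is not found by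
   inference: the one for subprobabilities takes precedence. *)
have /sigma_finiteP[F [FT ndF mF]] := sigma_finiteT (@lebesgue_measure R).
have /sigma_finiteP[G [GT ndG mG]] := sigma_finiteT mu.
pose uncons (x : 'rV[R]_n.+1) : measurableTypeR R * 'rV[R]_n :=
  (x ord0 ord0, \row_j x ord0 (lift ord0 j)).
have muncons : measurable_fun setT uncons.
  apply: measurable_fun_pair; first exact: measurable_coord.
  apply: measurable_fun_rV => i; under eq_fun do rewrite mxE.
  exact: measurable_coord.
have consK : cancel cons_rV uncons.
  move=> [a x]; congr pair; first by rewrite mxE unlift_none.
  by apply/rowP => j; rewrite !mxE liftK.
exists (fun k => uncons @^-1` (F k `*` G k)).
  apply/esym; rewrite -subTset => x _.
  have [i _ Fi] : (\bigcup_i F i) (uncons x).1 by rewrite -FT.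
  have [j _ Gj] : (\bigcup_j G j) (uncons x).2 by rewrite -GT.
  exists (maxn i j) => //; split.
    by move: Fi; exact/subsetPset/ndF/leq_maxl.
  by move: Gj; exact/subsetPset/ndG/leq_maxr.
move=> k; have [mFk Fkoo] := mF k; have [mGk Gkoo] := mG k; split.
  by rewrite -[X in measurable X]setTI; apply: muncons => //; exact: measurableX.
rewrite /lebesgue_rV_succ /pushforward -comp_preimage.
rewrite (_ : uncons \o cons_rV = id); last by apply/funext => x /=.
by rewrite preimage_id product_measure1E// lte_mul_pinfty// ge0_fin_numE.
Qed.

HB.instance Definition _ :=
  Measure_isSigmaFinite.Build _ _ _ lebesgue_rV_succ
    lebesgue_rV_succ_sigma_finite.

End lebesgue_rV_succ.

(* Lebesgue measure on R^n, as an iterated product of the one on R. *)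
Fixpoint lebesgue_rV (R : realType) (n : nat) :
    {sigma_finite_measure set 'rV[R]_n -> \bar R} :=
  if n is m.+1 then @lebesgue_rV_succ R m (lebesgue_rV R m)
  else \d_(0 : 'rV[R]_0).

(* The notations of [mpoly] clash with those of MathComp-Analysis. *)
Import -(notations) mpoly.
Notation "{ 'mpoly' R [ n ] }" := (mpoly n R)
  (at level 0, R at level 2, n at level 2, format "{ 'mpoly'  R [ n ] }").

Section polynomials.
Context {R : realType} {n : nat}.
Implicit Types (p : {mpoly R[n]}) (K B : set 'rV[R]_n).

Definition peval p (x : 'rV[R]_n) : R := meval (x ord0) p.

Definition basic_semialgebraic (m : nat) (g : 'I_m -> {mpoly R[n]}) :
  set 'rV[R]_n := [set x | forall i, 0 <= peval (g i) x].

(* Semialgebraic sets are the Boolean algebra generated by the sets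
   {p > 0}; {p = 0} is the complement of {p > 0} \/ {-p > 0}. *)
Inductive semialgebraic : set 'rV[R]_n -> Prop :=
| semialgebraic_gt0 p : semialgebraic [set x | 0 < peval p x]
| semialgebraicC A : semialgebraic A -> semialgebraic (~` A)
| semialgebraicU A A' :
    semialgebraic A -> semialgebraic A' -> semialgebraic (A `|` A').

Definition cart_prod (B_ : 'I_n -> set R) : set 'rV[R]_n :=
  [set x | forall i, B_ i (x ord0 i)].

(* [msize] is one more than the degree. *)
Definition feasible d K B : set {mpoly R[n]} :=
  [set p | [/\ (msize p <= d.+1)%N,
              forall x, K x -> 1 <= peval p x
            & forall x, B x -> 0 <= peval p x]].

Definition objective B p : \bar R :=
  (\int[lebesgue_rV R n]_(x in B) (peval p x)%:E)%E.

Definition optimal_value d K B : \bar R :=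
  ereal_inf [set objective B p | p in feasible d K B].

Definition optimal_solution d K B p :=
  feasible d K B p /\
  forall q, feasible d K B q -> (objective B p <= objective B q)%E.

End polynomials.

Section probability.
Context {d} {T : measurableType d} {R : realType} (P : probability T R).

Definition mutually_independent (I : choiceType) (F : I -> set (set T)) :=
  forall (J : {fset I}) (E : I -> set T),
    (forall i, i \in J -> F i (E i)) ->
    P (\bigcap_(i in [set` J]) E i) = (\prod_(i <- J) P (E i))%E.

Definition sigma_of d' (T' : measurableType d') (X : T -> T') : set (set T) :=
  preimage_set_system setT X measurable.

Definition draws_independent d1 d2 (T1 : measurableType d1)
    (T2 : measurableType d2) (xi : nat -> T -> T1) (u : nat -> T -> T2) :=
  mutually_independent (fun i : nat + nat =>
    match i with inl k => sigma_of (xi k) | inr k => sigma_of (u k) end).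

Definition has_density n (X : {RV P >-> 'rV[R]_n}) (f : 'rV[R]_n -> R) :=
  forall A, measurable A ->
    distribution P X A = (\int[lebesgue_rV R n]_(x in A) (f x)%:E)%E.

Definition has_density_proportional_to n (X : {RV P >-> 'rV[R]_n})
    (f : 'rV[R]_n -> R) (B : set 'rV[R]_n) :=
  exists c : R, has_density X (fun x => c * (\1_B x * f x)).

Definition uniform01 (X : {RV P >-> R}) :=
  forall A, measurable A -> distribution P X A = uniform_prob (@ltr01 R) A.

End probability.

Section algorithm.
Context {R : realType} {n : nat}.
Variables (K : set 'rV[R]_n) (p : {mpoly R[n]}).

(* [run xi u N x]: when the successive draws of step 2 are read from the
   stream [xi] and those of step 4 from the stream [u], the algorithm returns
   [x] after exactly [N] draws of step 2. A number is consumed from [u] only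
   when step 4 is reached. There is no [N], [x] if the algorithm loops. *)
Inductive run (xi : nat -> 'rV[R]_n) (u : nat -> R) : nat -> 'rV[R]_n -> Prop :=
| run_outside N x :
    ~ K (xi 0%N) -> run (fun k => xi k.+1) u N x -> run xi u N.+1 x
| run_accept :
    K (xi 0%N) -> u 0%N * peval p (xi 0%N) <= 1 -> run xi u 1%N (xi 0%N)
| run_reject N x :
    K (xi 0%N) -> 1 < u 0%N * peval p (xi 0%N) ->
    run (fun k => xi k.+1) (fun k => u k.+1) N x -> run xi u N.+1 x.

(* [ereal_inf] selects the only possible N, and is +oo if there is none. *)
Definition num_draws (xi : nat -> 'rV[R]_n) (u : nat -> R) : \bar R :=
  ereal_inf [set N%:R%:E | N in [set N | exists x, run xi u N x]].

Definition acceptance_rate d (T : measurableType d) (P : probability T R)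
    (xi : nat -> T -> 'rV[R]_n) (u : nat -> T -> R) : \bar R :=
  ((\int[P]_w num_draws (fun k => xi k w) (fun k => u k w))^-1)%E.

End algorithm.

(* Main.v *)
From HB Require Import structures.
Require Import Defs.
From mathcomp Require Import all_boot all_order all_algebra finmap.
From mathcomp Require Import all_classical all_reals all_analysis.
From mathcomp Require Import measurable_realfun.
From mathcomp Require mpoly.
Set Implicit Arguments.
Unset Strict Implicit.
Import Order.TTheory GRing.Theory Num.Theory.
Import numFieldNormedType.Exports.
Local Open Scope classical_set_scope.
Local Open Scope ring_scope.

(** Why the theorem holds. Let [w] be the integral of [p] over [B], so that the
    candidates have density [c * p] on [B] with [c = 1 / w]
    ([density_constant]). A candidate [x] in [K] passes the test
    [u * p x <= 1] with probability [1 / p x], because [p x >= 1]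
    ([uniform01_le_inv]); integrating against [c * p x], one round accepts
    and lands in [A] with probability [c * vol (K /\ A)]
    ([probability_accept_region]). So accepted points have a constant density
    on [K], and each round succeeds with probability
    [q = c * vol K = vol K / w]. This [q] is positive because [K] contains a
    cube ([lebesgue_rV_interior_gt0]).

    The rounds are independent, so round [k] is reached with probability
    [(1 - q) ^ k] ([probability_still]). Summing over [k], the expected number
    of rounds is [1 / q] ([expected_num_draws]), the algorithm stops almost
    surely ([probability_never]), and the output lies in [A] with probability
    [c * vol (K /\ A) / q = vol (K /\ A) / vol K] ([probability_returned]).

    The delicate point is the independence of the rounds: the number of uniform
    draws consumed before a given round is random, since a uniform number is
    drawn only for candidates in [K]. The event of reaching round [k] is
    therefore split according to that number [j]. On each piece the next uniform
    draw has the fixed index [j], and the piece is independent of every draw not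
    read so far ([fresh_state]). The notion [fresh] isolates this independence,
    and is preserved by reading one candidate ([fresh_next_draw]) or one
    candidate together with one uniform draw ([fresh_next_pair]). *)

(** * Measurability of semialgebraic sets and volume of sets with interior *)

Section sets_and_volume.
Context {R : realType} {n : nat}.

Lemma measurable_peval (p : {mpoly R[n]}) : measurable_fun setT (peval p).
Proof.
rewrite /peval; under eq_fun do rewrite mpoly.mevalE.
apply: measurable_sum => m; apply: measurable_funM; first exact: measurable_cst.
apply: measurable_prod => i _; apply: measurable_funX.
exact: measurable_coord.
Qed.

Lemma measurable_basic_semialgebraic m (g : 'I_m -> {mpoly R[n]}) :
  measurable (basic_semialgebraic g).
Proof.
rewrite (_ : basic_semialgebraic g =
    \bigcap_(i in [set: 'I_m]) (peval (g i) @^-1` `[0, +oo[)).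
  apply: fin_bigcap_measurable => // i _.
  rewrite -[X in measurable X]setTI; apply: measurable_peval => //.
by apply/seteqP; split => x /= gx i => [_|]; have := gx i;
  rewrite /= in_itv/= andbT => // /(_ I).
Qed.

Lemma measurable_semialgebraic (A : set 'rV[R]_n) :
  semialgebraic A -> measurable A.
Proof.
elim=> [p|{}A _ mA|{}A A' _ mA _ mA'].
- rewrite (_ : [set x | _] = setT `&` peval p @^-1` `]0, +oo[).
    exact: measurable_peval.
  by rewrite setTI; apply/seteqP; split => x /=; rewrite in_itv/= andbT.
- exact: measurableC.
- exact: measurableU.
Qed.

End sets_and_volume.

Definition open_cube (R : realType) n (x : 'rV[R]_n) (e : R) : set 'rV[R]_n :=
  [set y | forall i, ball (x ord0 i) e (y ord0 i)].

Lemma measurable_open_cube (R : realType) n (x : 'rV[R]_n) (e : R) :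
  measurable (open_cube x e).
Proof.
rewrite (_ : open_cube x e =
    \bigcap_(i in [set: 'I_n])
      ((fun y : 'rV[R]_n => y ord0 i) @^-1` ball (x ord0 i) e)).
  apply: fin_bigcap_measurable => // i _.
  rewrite -[X in measurable X]setTI; apply: measurable_coord => //.
  exact: measurable_ball.
by apply/seteqP; split => y /= xy i => [_|]; have := xy i => // /(_ I).
Qed.

(** Splitting off the first coordinate turns a cube into an interval times a
    cube of one dimension less, matching the recursive construction of the
    measure. In dimension 0 the cube is the whole one-point space. *)
Lemma lebesgue_rV_open_cube_gt0 (R : realType) n (x : 'rV[R]_n) (e : R) :
  0 < e -> (0 < lebesgue_rV R n (open_cube x e))%E.
Proof.
move=> e0; elim: n x => [|n IHn] x /=.
  by rewrite diracE mem_set ?lte01//= => -[].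
rewrite /lebesgue_rV_succ /pushforward.
pose x' : 'rV[R]_n := \row_j x ord0 (lift ord0 j).
rewrite (_ : _ @^-1` _ = ball (x ord0 ord0) e `*` open_cube x' e); last first.
  apply/seteqP; split => -[a y] /=.
    move=> xy; split => [|j]; first by have := xy ord0; rewrite mxE unlift_none.
    by have := xy (lift ord0 j); rewrite !mxE liftK.
  move=> [xa xy] i; rewrite mxE; case: unliftP => [j ->|->//].
  by have := xy j; rewrite mxE.
rewrite product_measure1E//; last 2 first.
- exact: measurable_ball.
- exact: measurable_open_cube.
rewrite mule_gt0 ?IHn//.
rewrite [ltRHS](lebesgue_measure_ball (x ord0 ord0) (ltW e0)) lte_fin.
by rewrite pmulrn_lgt0.
Qed.

(** The topology of row vectors is that of the sup norm, whose balls are the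
    open cubes. *)
Lemma lebesgue_rV_interior_gt0 (R : realType) n (K : set 'rV[R]_n) :
  measurable K -> K° !=set0 -> (0 < lebesgue_rV R n K)%E.
Proof.
move=> mK [x /nbhs_ballP[e /= e0 xeK]].
apply: lt_le_trans (lebesgue_rV_open_cube_gt0 x e0) _.
apply: le_measure; rewrite ?inE//; first exact: measurable_open_cube.
move=> y xy; apply: xeK; split => // i j; rewrite ord1; exact: xy.
Qed.

(** * Integration against a density, and the uniform law *)

Section density.
Context {d} {T : measurableType d} {R : realType}.
Local Open Scope ereal_scope.

(** The function [f] is only one version of the density; it agrees almost
    everywhere with the Radon-Nikodym derivative, for which the change of
    measure is known. *)
Lemma integral_density (mu : {sigma_finite_measure set T -> \bar R})
    (nu : {finite_measure set T -> \bar R}) (f g : T -> \bar R) :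
  measurable_fun setT f -> (forall x, 0 <= f x) ->
  (forall A, measurable A -> nu A = \int[mu]_(x in A) f x) ->
  measurable_fun setT g -> (forall x, 0 <= g x) ->
  \int[nu]_x g x = \int[mu]_x (g x * f x).
Proof.
move=> mf f0 nuE mg g0.
have numu : nu `<< mu.
  apply/null_content_dominatesP => A mA muA0; rewrite nuE//.
  by rewrite null_set_integral//; exact: measurable_funTS.
have f_int : mu.-integrable setT f.
  apply/integrableP; split => //; under eq_integral do rewrite gee0_abs//.
  by rewrite -nuE//; exact: fin_num_fun_lty.
rewrite -(Radon_Nikodym_SigmaFinite.change_of_variables numu)//.
have fi := Radon_Nikodym_SigmaFinite.f_integrable numu.
apply: ge0_ae_eq_integral => //.
- by apply: emeasurable_funM => //; exact: measurable_int fi.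
- exact: emeasurable_funM.
- by move=> x _; rewrite mule_ge0// Radon_Nikodym_SigmaFinite.f_ge0.
- by move=> x _; rewrite mule_ge0.
apply: ae_eqe_mul2l; apply: integral_ae_eq => // E _ mE.
by rewrite -nuE// -Radon_Nikodym_SigmaFinite.f_integral.
Qed.

(** This is why the acceptance test cancels the density: a candidate [x] with
    [q = p x] survives with probability [1 / p x]. The assumption [1 <= q] keeps
    [1 / q] inside the support of the uniform law. *)
Lemma uniform01_le_inv (q : R) : (1 <= q)%R ->
  uniform_prob (@ltr01 R) [set t | (t * q <= 1)%R] = (q^-1)%:E.
Proof.
move=> q1; have q0 : (0 < q)%R by exact: lt_le_trans q1.
rewrite /uniform_prob integral_uniform_pdf.
rewrite (_ : _ `&` _ = `[0%R, (q^-1)%R]%classic); last first.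
  apply/seteqP; split => t /=; rewrite !in_itv/=.
    by move=> [tq /andP[-> _]]; rewrite -[(q^-1)%R]mul1r ler_pdivlMr.
  move=> /andP[-> tq]; rewrite -ler_pdivlMr// mul1r tq; split => //=.
  by rewrite (le_trans tq)// invf_le1.
rewrite (eq_integral (cst 1)).
  rewrite integral_cst//= mul1e lebesgue_measure_itv/= lte_fin invr_gt0 q0.
  by rewrite sube0.
move=> t; rewrite inE/= in_itv/= => /andP[t0 tq].
by rewrite /uniform_pdf t0 (le_trans tq) ?invf_le1//= subr0 invr1.
Qed.

End density.

(** * Independence of the past and of the unread draws *)

Section joint_law.
Context {d d1 d2} {T : measurableType d} {T1 : measurableType d1}
  {T2 : measurableType d2} {R : realType} (P : probability T R).
Local Open Scope ereal_scope.

(** Independence gives product formulas on rectangles; uniqueness of the product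
    measure extends them to arbitrary measurable sets of pairs. The event [D]
    stands for the past together with further draws, so that the formula can be
    used in an induction over successive draws. *)
Lemma joint_law (X : {RV P >-> T1}) (Y : {RV P >-> T2}) (D : set T)
    (r : {nonneg R}) : measurable D ->
  (forall A B, measurable A -> measurable B ->
    P (X @^-1` A `&` (Y @^-1` B `&` D)) =
    r%:num%:E * (P (X @^-1` A) * P (Y @^-1` B))) ->
  forall C, measurable C ->
    P ((fun w => (X w, Y w)) @^-1` C `&` D) =
    r%:num%:E * (distribution P X \x distribution P Y) C.
Proof.
move=> mD XYD C mC.
have mXY : measurable_fun setT (fun w => (X w, Y w)).
  exact: measurable_fun_pair.
pose Q : {measure set (T1 * T2) -> \bar R} :=
  pushforward (mrestr P mD) (fun w => (X w, Y w)).
transitivity ((mscale r (distribution P X) \x distribution P Y) C); last first.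
  rewrite /product_measure1 ge0_integral_mscale//.
  exact: measurable_fun_xsection.
apply/esym; apply: (@product_measure_unique _ _ _ _ _
  (mscale r (distribution P X)) (distribution P Y) (Q mXY)) => // A B mA mB.
by rewrite -[RHS]muleA -XYD// setIA.
Qed.

End joint_law.

Section fresh_events.
Context {d d1 d2} {T : measurableType d} {T1 : measurableType d1}
  {T2 : measurableType d2} {R : realType} (P : probability T R).
Variables (xi : nat -> {RV P >-> T1}) (u : nat -> {RV P >-> T2}).
Local Open Scope ereal_scope.

Definition draw_events (i : nat + nat) : set (set T) :=
  match i with inl k => sigma_of (xi k) | inr k => sigma_of (u k) end.

(** Two separate counters record how far each stream has been read, because a
    number of the second stream is consumed only by some of the candidates. *)
Definition unread (k j : nat) (i : nat + nat) : bool :=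
  match i with inl k' => (k <= k')%N | inr j' => (j <= j')%N end.

(** Independence of what happened so far from the unread draws. The product over
    a finite family is the form that allows inductions: reading a draw moves one
    factor from the unread side to the event. *)
Definition fresh (k j : nat) (H : set T) : Prop :=
  measurable H /\
  forall (J : {fset (nat + nat)%type}) (E : nat + nat -> set T),
    (forall i, i \in J -> unread k j i /\ draw_events i (E i)) ->
    P (H `&` \bigcap_(i in [set` J]) E i) = P H * \prod_(i <- J) P (E i).

Lemma measurable_draw_event i A : draw_events i A -> measurable A.
Proof.
by case: i => k [B mB <-]; rewrite setTI -[X in measurable X]setTI;
  exact: measurable_funPT.
Qed.

Lemma measurable_draw_events (J : {fset (nat + nat)%type}) E :
  (forall i, i \in J -> draw_events i (E i)) ->
  measurable (\bigcap_(i in [set` J]) E i).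
Proof.
by move=> JE; rewrite bigcap_fset big_seq; apply: bigsetI_measurable => i /JE;
  exact: measurable_draw_event.
Qed.

Lemma fresh_setT : draws_independent P xi u -> fresh 0 0 setT.
Proof.
move=> indep; split=> // J E JE.
by rewrite setTI probability_setT mul1e; apply: indep => i /JE[_]; case: i {JE}.
Qed.

Lemma fresh_set0 k j : fresh k j set0.
Proof. by split=> // J E _; rewrite set0I measure0 mul0e. Qed.

Lemma freshU k j H H' : H `&` H' = set0 ->
  fresh k j H -> fresh k j H' -> fresh k j (H `|` H').
Proof.
move=> HH' [mH fH] [mH' fH']; split=> [|J E JE]; first exact: measurableU.
have mE : measurable (\bigcap_(i in [set` J]) E i).
  by apply: measurable_draw_events => i /JE[].
have PU B B' : measurable B -> measurable B' -> B `&` B' = set0 ->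
    P (B `|` B') = P B + P B' by move=> *; exact: measureU.
rewrite setIUl !PU ?fH ?fH' ?ge0_muleDl//; [exact: measurableI..|].
by rewrite setIACA HH' set0I.
Qed.

(* A family of events, with the event at index [i0] set to [A]: it expresses
   one more factor of a product of events as a larger family. *)
Let extend (i0 : nat + nat) A (E : nat + nat -> set T) i :=
  if i == i0 then A else E i.

Let extend_bigcap i0 A E (J : {fset (nat + nat)%type}) : i0 \notin J ->
  \bigcap_(i in [set` (i0 |` J)%fset]) extend i0 A E i =
  A `&` \bigcap_(i in [set` J]) E i.
Proof.
move=> i0J; rewrite bigcap_fsetU1 /extend eqxx; congr setI.
apply: eq_bigcapr => i /= iJ; case: eqP => // ii0.
by rewrite -ii0 iJ in i0J.
Qed.

Let extend_prod i0 A E (J : {fset (nat + nat)%type}) : i0 \notin J ->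
  \prod_(i <- (i0 |` J)%fset) P (extend i0 A E i) =
  P A * \prod_(i <- J) P (E i).
Proof.
move=> i0J; rewrite big_fsetU1//= /extend eqxx; congr *%E.
rewrite big_seq [RHS]big_seq; apply: eq_bigr => i /= iJ; case: eqP => // ii0.
by rewrite -ii0 iJ in i0J.
Qed.

(** The next draw of the first stream is one more factor of the family, and what
    remains unread is independent of it. *)
Lemma fresh_next_draw k j H A : measurable A -> fresh k j H ->
  P (H `&` xi k @^-1` A) = P H * P (xi k @^-1` A) /\
  fresh k.+1 j (H `&` xi k @^-1` A).
Proof.
move=> mA [mH fH].
have mxi : measurable (xi k @^-1` A).
  by rewrite -[X in measurable X]setTI; exact: measurable_funPT.
have PHA : P (H `&` xi k @^-1` A) = P H * P (xi k @^-1` A).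
  have := fH [fset (inl k : nat + nat)%type]%fset (fun=> xi k @^-1` A).
  rewrite set_fset1 bigcap_set1 big_seq_fset1; apply=> i /fset1P ->.
  by split=> /=; [exact: leqnn|exists A; rewrite ?setTI].
split => //; split=> [|J E JE]; first exact: measurableI.
have kJ : inl k \notin J by apply/negP => /JE[]/=; rewrite ltnn.
rewrite -setIA -(extend_bigcap _ _ kJ) fH ?extend_prod ?PHA ?muleA// => i.
rewrite /extend => /fset1UP[->|iJ].
  by rewrite eqxx /= leqnn; split=> //; exists A; rewrite ?setTI.
have [Ui Ei] := JE _ iJ; case: eqP => [ii0|_].
  by move: kJ; rewrite -ii0 iJ.
by split=> //; case: i {iJ Ei} Ui => //= l; exact: ltnW.
Qed.

(** Consuming one draw of each stream and testing the pair against an arbitrary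
    measurable set: on rectangles this is two more factors of the family, and
    [joint_law] passes to general sets. *)
Lemma fresh_next_pair k j H C : measurable C -> fresh k j H ->
  P (H `&` (fun w => (xi k w, u j w)) @^-1` C) =
    P H * (distribution P (xi k) \x distribution P (u j)) C /\
  fresh k.+1 j.+1 (H `&` (fun w => (xi k w, u j w)) @^-1` C).
Proof.
move=> mC [mH fH].
have mxiu : measurable ((fun w => (xi k w, u j w)) @^-1` C).
  rewrite -[X in measurable X]setTI.
  by have := measurable_fun_pair (measurable_funPT (xi k))
    (measurable_funPT (u j)); exact.
have pull (J : {fset (nat + nat)%type}) (E : nat + nat -> set T) :
    (forall i, i \in J -> unread k.+1 j.+1 i /\ draw_events i (E i)) ->
    P (H `&` (fun w => (xi k w, u j w)) @^-1` C `&`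
       \bigcap_(i in [set` J]) E i) =
    P H * (\prod_(i <- J) P (E i)) *
      (distribution P (xi k) \x distribution P (u j)) C.
  move=> JE.
  have mE : measurable (\bigcap_(i in [set` J]) E i).
    by apply: measurable_draw_events => i /JE[].
  have jJ : inr j \notin J by apply/negP => /JE[]/=; rewrite ltnn.
  have kJ : inl k \notin (inr j |` J)%fset.
    by apply/negP => /fset1UP[//|/JE[]]/=; rewrite ltnn.
  have r_fin : P H * (\prod_(i <- J) P (E i)) \is a fin_num.
    rewrite fin_numM// ?fin_num_measure// big_seq; apply: prode_fin_num => i.
    by move=> /JE[_ /measurable_draw_event]; exact: fin_num_measure.
  have r_ge0 : (0 <= fine (P H * (\prod_(i <- J) P (E i))))%R.
    by rewrite fine_ge0// mule_ge0// prode_ge0.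
  rewrite -(fineK r_fin) setIC setIA [X in P X]setIC.
  have := @joint_law _ _ _ _ _ _ _ P (xi k) (u j)
    (\bigcap_(i in [set` J]) E i `&` H) (NngNum r_ge0).
  apply=> //; first exact: measurableI.
  move=> A B mA mB /=; rewrite fineK//.
  rewrite setIA setIA [X in P X]setIC -setIA.
  rewrite -(extend_bigcap _ _ jJ) -(extend_bigcap _ _ kJ) fH.
    by rewrite !extend_prod// -[RHS]muleA; congr *%E; rewrite muleA muleC.
  move=> i; rewrite /extend => /fset1UP[->|].
    by rewrite eqxx /= leqnn; split=> //; exists A; rewrite ?setTI.
  case/fset1UP => [->|iJ].
    by rewrite eqxx /= leqnn; split=> //; exists B; rewrite ?setTI.
  have [Ui Ei] := JE _ iJ; case: eqP => [ii0|_].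
    by move: Ui; rewrite ii0 /= ltnn.
  case: eqP => [ii0|_]; first by move: Ui; rewrite ii0 /= ltnn.
  by split=> //; case: i {iJ Ei} Ui => //= l; exact: ltnW.
have PHC : P (H `&` (fun w => (xi k w, u j w)) @^-1` C) =
    P H * (distribution P (xi k) \x distribution P (u j)) C.
  (* The family of unread draws is empty here. *)
  have := pull fset0 (fun=> set0); rewrite set_fset0 bigcap_set0 setIT.
  by rewrite big_seq_fset0 mule1; exact.
split=> //; split=> [|J E JE]; first exact: measurableI.
by rewrite pull// PHC muleAC.
Qed.

End fresh_events.

(** * Executions as first acceptances *)

Section trajectories.
Context {R : realType} {n : nat}.
Variables (K : set 'rV[R]_n) (p : {mpoly R[n]}).
Implicit Types (xi : nat -> 'rV[R]_n) (u : nat -> R).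

(** The number of draws consumed from the second stream before round [k]: rounds
    whose candidate lies outside [K] consume none. *)
Definition used xi k : nat := (\sum_(i < k) (xi i \in K))%N.

Definition accepts xi u k : Prop :=
  K (xi k) /\ u (used xi k) * peval p (xi k) <= 1.

Definition pending xi u k : Prop := forall i, (i < k)%N -> ~ accepts xi u i.

Lemma used0 xi : used xi 0 = 0%N.
Proof. by rewrite /used big_ord0. Qed.

Lemma usedS xi k : used xi k.+1 = (used xi k + (xi k \in K))%N.
Proof. by rewrite /used big_ord_recr. Qed.

(** This is how the constructors of [run] recurse: dropping round 0 removes the
    head of the stream of candidates, and the head of the other stream only if
    round 0 consumed it. *)
Lemma acceptsS xi u k : accepts xi u k.+1 =
  accepts (fun i => xi i.+1) (fun j => u ((xi 0%N \in K) + j)%N) k.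
Proof. by rewrite /accepts /used big_ord_recl. Qed.

Lemma pendingS xi u k : pending xi u k.+1 =
  (pending xi u k /\ ~ accepts xi u k).
Proof.
apply/propext; split=> [pe|[pe na] i].
  by split=> [i ik|]; apply: pe => //; exact: ltnW.
by rewrite ltnS leq_eqVlt => /predU1P[->|/pe].
Qed.

Lemma pending_shift xi u k : pending xi u k.+1 = (~ accepts xi u 0 /\
  pending (fun i => xi i.+1) (fun j => u ((xi 0%N \in K) + j)%N) k).
Proof.
apply/propext; split=> [pe|[na pe] [//|i]]; last first.
  by rewrite ltnS acceptsS; exact: pe.
by split=> [|i ik]; [exact: pe|rewrite -acceptsS; exact: pe].
Qed.

(** The inductive semantics is that of a first success: a return after [k.+1]
    draws is the first acceptance happening at round [k]. *)
Lemma runP xi u N x : run K p xi u N x <->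
  exists k, [/\ N = k.+1, pending xi u k, accepts xi u k & x = xi k].
Proof.
split=> [|[k [-> + + ->]]].
- elim=> {xi u N x} [xi u N x nK _ [k [-> pe ac ->]]|xi u K0 acc|
    xi u N x K0 rej _ [k [-> pe ac ->]]].
  + exists k.+1; rewrite pending_shift acceptsS memNset//; split=> //.
    by split=> // -[].
  + by exists 0%N; rewrite /accepts used0; split.
  + exists k.+1; rewrite pending_shift acceptsS mem_set//; split=> //.
    by split=> // -[_]; rewrite used0 leNgt rej.
- elim: k xi u => [|k IHk] xi u.
    by rewrite /accepts used0 => _ [K0 acc]; exact: run_accept.
  rewrite pending_shift acceptsS => -[na pe] ac.
  have [K0|nK0] := pselect (K (xi 0%N)); last first.
    by apply: run_outside => //; rewrite memNset// in pe ac; exact: IHk.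
  apply: run_reject => //; last by rewrite mem_set// in pe ac; exact: IHk.
  by rewrite ltNge; apply/negP => acc; apply: na; split=> //; rewrite used0.
Qed.

Lemma pending_le xi u k l : (k <= l)%N -> pending xi u l -> pending xi u k.
Proof. by move=> kl pe i ik; apply: pe; exact: leq_trans kl. Qed.

Lemma first_accept_uniq xi u k l : pending xi u k -> accepts xi u k ->
  pending xi u l -> accepts xi u l -> k = l.
Proof.
move=> pek ack pel acl; case: (ltngtP k l) => // [kl|lk].
  by have := pel _ kl.
by have := pek _ lk.
Qed.

Lemma first_accept xi u k : ~ pending xi u k ->
  exists l, pending xi u l /\ accepts xi u l.
Proof.
elim: k => [|k IHk]; first by move=> pe; exfalso; apply: pe.
rewrite pendingS => /not_andP pe; have [pk|/IHk//] := pselect (pending xi u k).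
by exists k; split => //; case: pe => // /contrapT.
Qed.

(** The tail-sum formula: round [k] contributes one draw exactly when it is
    reached. It also covers executions that never stop, both sides being then
    infinite. *)
Lemma num_drawsE xi u : num_draws K p xi u =
  (\sum_(k <oo) (`[< pending xi u k >]%:R)%:E)%E.
Proof.
rewrite /num_draws.
have [[l [pe ac]]|nac] := pselect (exists l, pending xi u l /\ accepts xi u l).
- have -> : [set N%:R%:E | N in [set N | exists x, run K p xi u N x]] =
      [set l.+1%:R%:E] :> set (\bar R).
    apply/seteqP; split=> [_ [N [x /runP[k [-> pe' ac' _]]] <-]|_ ->] /=.
      by rewrite (first_accept_uniq pe' ac' pe ac).
    by exists l.+1 => //; exists (xi l); apply/runP; exists l.
  rewrite ereal_inf1 (nneseries_split 0 l.+1)// add0n.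
  rewrite [X in (_ + X)%E]eseries0 ?adde0; last first.
    move=> k lk _ /=; case: asboolP => // pek; exfalso.
    by apply: (pek l).
  rewrite sumEFin big_mkord (eq_bigr (fun=> 1)).
    by rewrite sumr_const card_ord.
  move=> [i /= il] _; case: asboolP => // npe; exfalso; apply: npe.
  exact: pending_le pe.
- rewrite (_ : [set N%:R%:E | N in [set N | exists x, run K p xi u N x]] = set0)
    ?ereal_inf0; last first.
    apply/seteqP; split=> // y [N [x /runP[k [_ pe ac _]]] _].
    by apply: nac; exists k.
  have pe k : pending xi u k by apply: contrapT => /first_accept.
  apply/esym; under eq_eseriesr do rewrite asboolT//.
  apply/cvg_lim => //.
  rewrite (_ : (fun _ => _) = (fun k => (k%:R : R)%:E)).
    exact/cvgenyP/cvg_id.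
  by apply/funext => k; rewrite sumEFin big_mkord sumr_const card_ord.
Qed.

End trajectories.

(** * Repeated independent rounds *)

Lemma nneseries_geometric (R : realType) (x q : R) : 0 < q -> q <= 1 ->
  (\sum_(k <oo) (x * (1 - q) ^+ k)%:E = (x / q)%:E)%E.
Proof.
move=> q_gt0 q_le1; apply/cvg_lim => //.
rewrite (_ : (fun _ => _) = EFin \o series (geometric x (1 - q))); last first.
  by apply/funext => k /=; rewrite /series/= sumEFin.
apply: cvg_EFin; first exact: nearW.
have := @cvg_geometric_series R x (1 - q).
by rewrite subKr; apply; rewrite ger0_norm ?subr_ge0// gtrBl.
Qed.

Section rejection_sampling.
Context {d} {T : measurableType d} {R : realType} (P : probability T R).
Context {n : nat} (K : set 'rV[R]_n) (p : {mpoly R[n]}) (mK : measurable K).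
Variables (xi : nat -> {RV P >-> 'rV[R]_n}) (u : nat -> {RV P >-> R}).
Hypothesis indep : draws_independent P xi u.
Local Open Scope ereal_scope.

Definition accept_region (A : set 'rV[R]_n) : set ('rV[R]_n * R) :=
  [set z | (K `&` A) z.1 /\ (z.2 * peval p z.1 <= 1)%R].

Definition reject_region : set ('rV[R]_n * R) :=
  [set z | K z.1 /\ (1 < z.2 * peval p z.1)%R].

Let measurable_threshold :
  measurable_fun setT (fun z : 'rV[R]_n * R => z.2 * peval p z.1)%R.
Proof.
apply: measurable_funM; first exact: measurable_snd.
by apply: measurableT_comp; [exact: measurable_peval|exact: measurable_fst].
Qed.

Lemma measurable_accept_region A : measurable A -> measurable (accept_region A).
Proof.
move=> mA; rewrite (_ : accept_region A =
    fst @^-1` (K `&` A) `&`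
    (fun z : 'rV[R]_n * R => z.2 * peval p z.1)%R @^-1` `]-oo, 1%R]).
  apply: measurableI; rewrite -[X in measurable X]setTI.
    by apply: measurable_fst => //; exact: measurableI.
  exact: measurable_threshold.
by apply/seteqP; split => z /= []; rewrite in_itv.
Qed.

Lemma measurable_reject_region : measurable reject_region.
Proof.
rewrite (_ : reject_region = fst @^-1` K `&`
    (fun z : 'rV[R]_n * R => z.2 * peval p z.1)%R @^-1` `]1%R, +oo[).
  apply: measurableI; rewrite -[X in measurable X]setTI.
    exact: measurable_fst.
  exact: measurable_threshold.
by apply/seteqP; split => z /= []; rewrite in_itv/= andbT.
Qed.

Let pair k j w := (xi k w, u j w).

(** The event that round [k] is reached is split below in pieces [state k j]
    according to the number [j] of draws consumed from the second stream, so
    that on each piece the index of the next such draw is deterministic. *)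
Definition still k : set T := [set w | pending K p (xi^~ w) (u^~ w) k].

Definition state k j : set T :=
  still k `&` [set w | used K (xi^~ w) k = j].

Definition stop k (A : set 'rV[R]_n) : set T :=
  still k `&` [set w | accepts K p (xi^~ w) (u^~ w) k /\ A (xi k w)].

Let state00 : state 0 0 = setT.
Proof. by rewrite -subTset => w _; split=> //=; exact: used0. Qed.

Let state0S j : state 0 j.+1 = set0.
Proof. by rewrite -subset0 => w [_ /=]; rewrite used0. Qed.

Let stateS0 k : state k.+1 0 = state k 0 `&` xi k @^-1` (~` K).
Proof.
apply/seteqP; split=> w.
  move=> [/=]; rewrite /still/= pendingS usedS => -[pe _] /eqP.
  rewrite addn_eq0 eqb0 => /andP[/eqP u0 xK]; split=> //.
  by move=> Kx; move: xK; rewrite mem_set.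
move=> [[pe/= u0] nK]; split; rewrite /still/=.
  by rewrite pendingS; split=> // -[].
by rewrite usedS u0 memNset.
Qed.

Let stateSS k j : state k.+1 j.+1 =
  state k j.+1 `&` xi k @^-1` (~` K) `|`
  state k j `&` pair k j @^-1` reject_region.
Proof.
apply/seteqP; split=> w.
  move=> [/=]; rewrite /still/= pendingS usedS => -[pe nac].
  have [Kx|nK] := pselect (K (xi k w)).
    rewrite mem_set// addn1 => -[uj]; right; split=> //; split=> //=.
    by rewrite ltNge; apply/negP => le1; apply: nac; rewrite /accepts uj.
  by rewrite memNset// addn0 => uj; left; split=> //; split.
move=> [[[pe/= uj] nK]|[[pe/= uj] [/= Kx gt1]]]; split; rewrite /still/=.
- by rewrite pendingS; split=> // -[].
- by rewrite usedS uj memNset// addn0.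
- by rewrite pendingS; split=> // -[_]; rewrite uj leNgt gt1.
- by rewrite usedS uj mem_set// addn1.
Qed.

(** By induction on the round: [state k.+1 j.+1] is reached either by a
    candidate outside [K], leaving the second counter unchanged, or by a
    rejected pair, advancing it. *)
Lemma fresh_state k j : fresh xi u k j (state k j).
Proof.
elim: k j => [|k IHk] [|j].
- by rewrite state00; exact: fresh_setT.
- by rewrite state0S; exact: fresh_set0.
- rewrite stateS0.
  have [_] := fresh_next_draw (measurableC mK) (IHk 0%N); exact.
- rewrite stateSS; apply: freshU.
  + apply/seteqP; split => // w [[_ nK] [_ [Kx _]]]; exact: (nK Kx).
  + have [_] := fresh_next_draw (measurableC mK) (IHk j.+1); exact.
  + have [_] := fresh_next_pair measurable_reject_region (IHk j); exact.
Qed.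

Let still_bigcup k : still k = \bigcup_j state k j.
Proof.
apply/seteqP; split=> [w pe|w [j _ []//]].
by exists (used K (xi^~ w) k).
Qed.

Let stop_bigcup k A :
  stop k A = \bigcup_j (state k j `&` pair k j @^-1` accept_region A).
Proof.
apply/seteqP; split=> [w [pe [[/= Kx acc] Ax]]|
    w [j _ [[pe/= uj] [[/= Kx Ax] acc]]]].
  by exists (used K (xi^~ w) k).
by split=> //; split=> //; split=> //; rewrite uj.
Qed.

Let measurable_state k j : measurable (state k j).
Proof. by have [] := fresh_state k j. Qed.

Let measurable_state_accept k j A : measurable A ->
  measurable (state k j `&` pair k j @^-1` accept_region A).
Proof.
move=> mA.
by have [_ []] :=
  fresh_next_pair (measurable_accept_region mA) (fresh_state k j).
Qed.

Lemma measurable_still k : measurable (still k).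
Proof. by rewrite still_bigcup; exact: bigcupT_measurable. Qed.

Lemma measurable_stop k A : measurable A -> measurable (stop k A).
Proof.
move=> mA; rewrite stop_bigcup; apply: bigcupT_measurable => j.
exact: measurable_state_accept.
Qed.

Let trivIset_state k : trivIset setT (state k).
Proof. by move=> i j _ _ [w [[_ /= <-] [_ /= <-]]]. Qed.

(* [L A] is the probability that one round accepts a candidate in [A]; its value
   is computed from the density of the candidates in the next part. *)
Variable L : set 'rV[R]_n -> R.
Hypothesis accept_law : forall k j A, measurable A ->
  (distribution P (xi k) \x distribution P (u j)) (accept_region A) = (L A)%:E.

(** On each [state k j] the pair examined at round [k] is [(xi k, u j)],
    which is independent of that state and accepted in [A] with a probability
    depending on neither index; hence round [k] succeeds independently of its
    being reached. *)
Lemma probability_stop k A : measurable A ->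
  P (stop k A) = (L A)%:E * P (still k).
Proof.
move=> mA; rewrite stop_bigcup still_bigcup !measure_bigcup//; last 2 first.
- by move=> j _; exact: measurable_state_accept.
- move=> i j _ _ [w [[si _] [sj _]]].
  by apply: (@trivIset_state k) => //; exists w.
rewrite -nneseriesZl//; apply: eq_eseriesr => j _.
have [PA _] := fresh_next_pair (measurable_accept_region mA) (fresh_state k j).
by rewrite [LHS]PA accept_law// muleC.
Qed.

(** A round that is reached either stops, with conditional probability
    [L setT], or leads to the next one: the number of rounds is geometric. *)
Lemma probability_still k : P (still k) = ((1 - L setT) ^+ k)%:E.
Proof.
elim: k => [|k IHk].
  by rewrite (_ : still 0 = setT) ?probability_setT//; exact/seteqP.
have : P (still k) = P (still k.+1) + P (stop k setT).
  rewrite -measureU//; [|exact: measurable_still|exact: measurable_stop|].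
  - congr (P _); apply/seteqP; split=> w; rewrite /still/= pendingS.
      move=> pe; have [ac|] := pselect (accepts K p (xi^~ w) (u^~ w) k).
        by right.
      by left.
    by move=> [|] [].
  - rewrite -subset0 => w []; rewrite /still/= pendingS.
    by move=> [_ nac] [_ [/nac]].
rewrite probability_stop// IHk => PS.
have fS : P (still k.+1) \is a fin_num.
  by apply: fin_num_measure; exact: measurable_still.
move: PS; rewrite -(fineK fS) -EFinM -EFinD => -[PS].
by congr EFin; rewrite exprS mulrBl mul1r {1}PS addrK.
Qed.

Hypothesis L_gt0 : (0 < L setT)%R.
Hypothesis L_le1 : (L setT <= 1)%R.

Lemma expected_num_draws :
  \int[P]_w num_draws K p (xi^~ w) (u^~ w) = ((L setT)^-1)%:E.
Proof.
under eq_integral do rewrite num_drawsE.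
rewrite integral_nneseries//; last first.
  move=> k; rewrite (_ : (fun _ => _) = EFin \o \1_(still k)).
    by apply/measurable_EFinP; exact: measurable_indic (measurable_still k).
  by apply/funext => w /=; rewrite indicE.
rewrite -[(_^-1)%R]mul1r -nneseries_geometric//; apply: eq_eseriesr => k _.
rewrite mul1r -probability_still -[still k]setIT -integral_indic//.
exact: measurable_still.
Qed.

Lemma probability_bigcup_stop A : measurable A ->
  P (\bigcup_k stop k A) = (L A / L setT)%:E.
Proof.
move=> mA; rewrite measure_semi_bigcup//=; last 3 first.
- by move=> k; exact: measurable_stop.
- move=> i j _ _ [w [[pei [aci _]] [pej [acj _]]]].
  exact: first_accept_uniq pei aci pej acj.
- by apply: bigcupT_measurable => k; exact: measurable_stop.
rewrite -nneseries_geometric//; apply: eq_eseriesr => k _.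
by rewrite probability_stop// probability_still EFinM.
Qed.

(** Completing the output by [0] on the negligible event [never] makes it
    a total function, as a random variable must be. *)
Definition returned (w : T) : 'rV[R]_n :=
  if pselect (exists k, pending K p (xi^~ w) (u^~ w) k /\
                        accepts K p (xi^~ w) (u^~ w) k) is left e
  then xi (projT1 (cid e)) w else 0%R.

Lemma returnedE k w : stop k setT w -> returned w = xi k w.
Proof.
move=> [pe [ac _]]; rewrite /returned; case: pselect => [e|[]].
  2: by exists k.
case: cid => l /= [pe' ac']; congr (xi _ w).
exact: first_accept_uniq pe' ac' pe ac.
Qed.

Definition never : set T := ~` \bigcup_k stop k setT.

Lemma measurable_never : measurable never.
Proof.
by apply: measurableC; apply: bigcupT_measurable => k; exact: measurable_stop.
Qed.

Lemma probability_never : P never = 0.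
Proof.
rewrite probability_setC ?probability_bigcup_stop//; last first.
  by apply: bigcupT_measurable => k; exact: measurable_stop.
by rewrite divff ?gt_eqF// subee.
Qed.

(** Gives measurability of the output, and its law up to a negligible set. *)
Lemma returned_preimage A :
  returned @^-1` A = \bigcup_k stop k A `|` (never `&` [set _ | A 0%R]).
Proof.
apply/seteqP; split=> w /=.
  have [[k _ sk]|nk] := pselect ((\bigcup_k stop k setT) w).
    rewrite (returnedE sk) => Ax; left; exists k => //.
    by case: sk => pe [ac _].
  rewrite /returned; case: pselect => [[k [pe ac]]|_ A0]; last by right.
  by exfalso; apply: nk; exists k.
move=> [[k _ [pe [ac Ax]]]|[nk A0]].
  by rewrite (@returnedE k).
rewrite /returned; case: pselect => [[k [pe ac]]|_//].
by exfalso; apply: nk; exists k.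
Qed.

Let measurable_never_default (A : set 'rV[R]_n) :
  measurable (never `&` [set _ | A 0%R]).
Proof.
apply: measurableI; first exact: measurable_never.
by have [A0|nA0] := pselect (A 0%R);
  [rewrite (_ : [set _ | _] = setT)|rewrite (_ : [set _ | _] = set0)] => //;
  apply/seteqP; split.
Qed.

Lemma measurable_returned : measurable_fun setT returned.
Proof.
move=> _ A mA; rewrite setTI returned_preimage; apply: measurableU => //.
by apply: bigcupT_measurable => k; exact: measurable_stop.
Qed.

Lemma probability_returned A : measurable A ->
  P (returned @^-1` A) = (L A / L setT)%:E.
Proof.
move=> mA; rewrite returned_preimage -probability_bigcup_stop//.
rewrite measureU0//.
- by apply: bigcupT_measurable => k; exact: measurable_stop.
- exact: (subset_measure0 _ measurable_never _ probability_never).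
Qed.

Lemma ae_run : {ae P, forall w, exists N,
  run K p (xi^~ w) (u^~ w) N (returned w)}.
Proof.
exists never; split; [exact: measurable_never|exact: probability_never|].
move=> w /= nrun [k _ sk]; apply: nrun; exists k.+1; apply/runP; exists k.
by rewrite (returnedE sk); case: sk => pe [ac _].
Qed.

End rejection_sampling.

(** * The law of one round *)

Section one_round.
Context {d} {T : measurableType d} {R : realType} (P : probability T R).
Context {n : nat} (K B : set 'rV[R]_n) (p : {mpoly R[n]}).
Hypotheses (mK : measurable K) (mB : measurable B) (KB : K `<=` B).
Hypotheses (p_ge1 : forall x, K x -> 1 <= peval p x)
  (p_ge0 : forall x, B x -> 0 <= peval p x).
Local Open Scope ereal_scope.

Let measurable_pB : measurable_fun setT (fun x => (\1_B x * peval p x)%:E).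
Proof.
apply/measurable_EFinP; apply: measurable_funM; first exact: measurable_indic.
exact: measurable_peval.
Qed.

Let pB_ge0 x : (0 <= \1_B x * peval p x)%R.
Proof.
rewrite indicE; have [xB|_] := boolP (x \in B); last by rewrite mul0r.
by rewrite mul1r p_ge0//; exact/set_mem.
Qed.

Lemma objectiveE :
  objective B p = \int[lebesgue_rV R n]_x (\1_B x * peval p x)%:E.
Proof.
rewrite /objective integral_mkcond; apply: eq_integral => x _.
by rewrite patchE indicE; case: ifPn => _; rewrite ?mul1r ?mul0r.
Qed.

(** The normalising constant is determined by the total mass being 1; a
    negative one would give a nonpositive mass. In particular the objective is
    finite and positive. *)
Lemma density_constant (X : {RV P >-> 'rV[R]_n}) (c : R) :
  has_density X (fun x => c * (\1_B x * peval p x))%R ->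
  (0 < c)%R /\ objective B p = (c^-1)%:E.
Proof.
move=> Xc; have := Xc setT measurableT; rewrite probability_setT => c1.
have obj_ge0 : 0 <= objective B p.
  by rewrite objectiveE; apply: integral_ge0 => x _; rewrite lee_fin.
have c_ge0 : (0 <= c)%R.
  rewrite leNgt; apply/negP => c_lt0.
  have : 1 <= (0 : \bar R); last by rewrite lee_fin ler10.
  rewrite c1 (_ : (fun x => _) = (fun x => - (- c * (\1_B x * peval p x))%:E)).
    rewrite integral_ge0N => [|x _]; last first.
      by rewrite lee_fin mulr_ge0// oppr_ge0 ltW.
    rewrite oppe_le0; apply: integral_ge0 => x _.
    by rewrite lee_fin mulr_ge0// oppr_ge0 ltW.
  by apply/funext => x; rewrite -EFinN mulNr opprK.
move: c1; under eq_integral do rewrite EFinM.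
rewrite ge0_integralZl//; last by move=> x _; rewrite lee_fin.
rewrite -objectiveE => c1.
have c_gt0 : (0 < c)%R.
  rewrite lt_neqAle c_ge0 andbT; apply/eqP => c0.
  by move: c1; rewrite -c0 mul0e => /eqP; rewrite eqe oner_eq0.
split=> //; move: c1 obj_ge0; case: (objective B p) => [w||] //.
  by rewrite -EFinM => -[c1] _; rewrite -[(c^-1)%R]mulr1 c1 mulKf// gt_eqF.
by rewrite gt0_muley.
Qed.

Lemma lebesgue_le_objective : lebesgue_rV R n K <= objective B p.
Proof.
rewrite objectiveE -[K]setIT -integral_indic//.
apply: ge0_le_integral => //.
  by apply/measurable_EFinP; exact: measurable_indic.
move=> x _; rewrite lee_fin indicE; have [/set_mem Kx|_//] := boolP (x \in K).
by rewrite indicE mem_set ?mul1r ?p_ge1//; exact: KB.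
Qed.

(** Fubini: given the candidate [x], the test succeeds with probability
    [1 / p x], which cancels the density [c * p x], so that accepted candidates
    are spread over [K] with the constant density [c]. *)
Lemma probability_accept_region (X : {RV P >-> 'rV[R]_n}) (Y : {RV P >-> R})
    (c : R) (A : set 'rV[R]_n) : (0 <= c)%R -> measurable A ->
  has_density X (fun x => c * (\1_B x * peval p x))%R -> uniform01 Y ->
  (distribution P X \x distribution P Y) (accept_region K p A) =
  c%:E * lebesgue_rV R n (K `&` A).
Proof.
move=> c0 mA Xc Yu; rewrite /product_measure1.
have mKA : measurable (K `&` A) by exact: measurableI.
have mKAp := measurable_accept_region p mK mA.
rewrite (@integral_density _ _ _ (lebesgue_rV R n) _
  (fun x => (c * (\1_B x * peval p x))%:E)); first last.
- by move=> x; exact: measure_ge0.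
- exact: measurable_fun_xsection.
- exact: Xc.
- by move=> x; rewrite lee_fin mulr_ge0.
- by under eq_fun do rewrite EFinM; exact: measurable_funeM.
rewrite -[K `&` A]setIT -integral_indic// -ge0_integralZl//; last first.
  by apply/measurable_EFinP; exact: measurable_indic.
apply: eq_integral => x _; rewrite /= Yu; last exact: measurable_xsection.
rewrite [\1_(K `&` A) x]indicE.
have [/set_mem[Kx Ax]|nKA] := boolP (x \in K `&` A); last first.
  rewrite (_ : xsection _ _ = set0) ?measure0 ?mul0e ?mule0//.
  rewrite -subset0 => t /xsectionP[KAx _].
  by move: nKA; rewrite mem_set.
rewrite (_ : xsection _ _ = [set t | (t * peval p x <= 1)%R]); last first.
  by apply/seteqP; split=> t; [move=> /xsectionP[]|move=> tp; apply/xsectionP].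
rewrite uniform01_le_inv ?p_ge1// mule1 -EFinM indicE
  mem_set ?mul1r//; last first.
  exact: KB.
by rewrite mulrCA mulVf ?mulr1// gt_eqF// (lt_le_trans _ (p_ge1 Kx)).
Qed.

End one_round.

Lemma optimal_valueE (R : realType) n d (K B : set 'rV[R]_n)
    (p : {mpoly R[n]}) :
  optimal_solution d K B p -> optimal_value d K B = objective B p.
Proof.
move=> [fp minp]; apply/eqP; rewrite eq_le; apply/andP; split.
  by apply: ereal_inf_lbound; exists p.
by apply/ereal_infP => y [q fq <-]; exact: minp.
Qed.

Theorem theorem1 (R : realType) (n m d : nat) (g : 'I_m -> {mpoly R[n]})
    (K : set 'rV[R]_n) (B_ : 'I_n -> set R) (B : set 'rV[R]_n)
    (K_def : K = basic_semialgebraic g)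
    (K_compact : compact K) (K_interior : K° !=set0)
    (B_def : B = cart_prod B_)
    (B_compact : compact B) (B_semialgebraic : semialgebraic B)
    (KB : K `<=` B)
    (d_gt0 : (0 < d)%N)
    (p : {mpoly R[n]}) (p_opt : optimal_solution d K B p)
    (disp : measure_display) (T : measurableType disp) (P : probability T R)
    (xi : nat -> {RV P >-> 'rV[R]_n}) (u : nat -> {RV P >-> R})
    (xi_density : forall k, has_density_proportional_to (xi k) (peval p) B)
    (u_uniform : forall k, uniform01 (u k))
    (indep : draws_independent P xi u) :
  optimal_value d K B = objective B p /\
  (exists2 X : {RV P >-> 'rV[R]_n},
    {ae P, forall w, exists N, run K p (xi ^~ w) (u ^~ w) N (X w)} &
    has_density X (fun x => \1_K x / fine (lebesgue_rV R n K))) /\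
  acceptance_rate K p P xi u =
    (lebesgue_rV R n K / optimal_value d K B)%E.
Proof.
have mK : measurable K by rewrite K_def; exact: measurable_basic_semialgebraic.
have mB := measurable_semialgebraic B_semialgebraic.
have [[_ p_ge1 p_ge0] _] := p_opt.
have volK_gt0 := lebesgue_rV_interior_gt0 mK K_interior.
have [c Xc] := xi_density 0%N.
have [c_gt0 objE] := density_constant mB p_ge0 Xc.
(* The total mass fixes the constant, so all candidates have one density. *)
have xi_c k : has_density (xi k) (fun x => c * (\1_B x * peval p x)).
  have [c' Xc'] := xi_density k.
  have [_ objE'] := density_constant mB p_ge0 Xc'.
  suff <- : c' = c by [].
  by apply: invr_inj; move: objE'; rewrite objE => -[].
have volK_le : (lebesgue_rV R n K <= (c^-1)%:E)%E.
  by rewrite -objE; exact: lebesgue_le_objective.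
have vol_fin A : measurable A -> lebesgue_rV R n (K `&` A) \is a fin_num.
  move=> mA; rewrite ge0_fin_numE//; apply: le_lt_trans (ltry c^-1).
  by apply: le_trans volK_le; apply: le_measure;
    rewrite ?inE//; exact: measurableI.
pose L A := c * fine (lebesgue_rV R n (K `&` A)).
have LT : L setT = c * fine (lebesgue_rV R n K) by rewrite /L setIT.
have volK_fin : lebesgue_rV R n K \is a fin_num.
  by rewrite -[K]setIT; exact: vol_fin.
have fvolK_gt0 : 0 < fine (lebesgue_rV R n K).
  by rewrite fine_gt0// volK_gt0 -ge0_fin_numE.
have LP k j A : measurable A ->
    (distribution P (xi k) \x distribution P (u j))%E (accept_region K p A) =
    (L A)%:E.
  move=> mA.
  rewrite (probability_accept_region mK mB KB p_ge1 p_ge0 (ltW c_gt0) mA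
    (xi_c k) (u_uniform j)).
  by rewrite /L EFinM fineK ?vol_fin.
have L_gt0 : 0 < L setT by rewrite LT mulr_gt0.
have L_le1 : L setT <= 1.
  by rewrite LT -ler_pdivlMl// mulr1 -lee_fin fineK.
split; first exact: optimal_valueE.
split.
- pose X : {mfun T >-> 'rV[R]_n} := HB.pack (returned K p xi u)
    (isMeasurableFun.Build _ _ _ _ _ (measurable_returned p mK indep)).
  exists X; first exact: (ae_run mK indep LP).
  move=> A mA.
  rewrite /distribution /pushforward (probability_returned mK indep LP)//.
  under eq_integral do rewrite mulrC EFinM.
  rewrite ge0_integralZl_EFin//; last 2 first.
  + by apply/measurable_EFinP/measurable_funTS; exact: measurable_indic.
  + by rewrite invr_ge0 ltW.
  rewrite [X in (_ * X)%E](_ : _ = (fine (lebesgue_rV R n (K `&` A)))%:E).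
    rewrite -EFinM; congr EFin.
    by rewrite LT /L invfM mulrACA divff ?mul1r 1?mulrC// gt_eqF.
  by rewrite integral_indic// fineK ?vol_fin.
- rewrite /acceptance_rate (expected_num_draws mK indep LP)//.
  rewrite (optimal_valueE p_opt) objE -(fineK volK_fin) !inver.
  by rewrite !invr_eq0 !gt_eqF// !invrK -EFinM LT mulrC.
Qed.
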